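(* Let $n\ge1$ and let $u_m$, $m=-\tfrac n2,-\tfrac n2+1,\dots,\tfrac n2$, be the (real) orthonormal eigenvectors of the symmetric Ehrenfest gauge $A_{\mathrm{sym}}$, with eigenvalue $2m/n$. Then: (1) $u_m$ is the $J_x$ eigenvector of eigenvalue $m$. In the $J_z$ basis its entries are, up to a column phase, the entries of the spin-$\tfrac n2$ rotation by $\tfrac\pi2$ about the $y$ axis, $$u_m(k)=\langle k-\tfrac n2|\,e^{-i\frac\pi2 J_y}\,|m\rangle,$$ the Wigner rotation matrix at $\tfrac\pi2$, which is real. (2) The rescaled entries $\mathrm K_m(k):=u_m(k)/\sqrt{\nu_k}$ are polynomials of degree $\tfrac n2-m$ in $k$, the (normalised, symmetric) Krawtchouk polynomials, orthogonal with respect to the binomial weight $\nu$: $\sum_{k}\nu_k\,\mathrm K_m(k)\mathrm K_{m'}(k)=\delta_{mm'}$. (3) The semigroup has the exact spectral (Karlin–McGregor) form $$\bigl(e^{tQ}\bigr)_{kl}=\frac{\sqrt{\nu_l}}{\sqrt{\nu_k}}\sum_{m=-n/2}^{n/2}e^{(2m-n)t}\,u_m(k)\,u_m(l)=\nu_l\sum_{m=-n/2}^{n/2}e^{(2m-n)t}\,\mathrm K_m(k)\,\mathrm K_m(l),\qquad k,l\in\{0,\dots,n\}.$$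
   Context: The symmetric Ehrenfest urn with $n$ balls is the continuous-time Markov chain on $\{0,\dots,n\}$ with generator $Q_{k,k-1}=k$, $Q_{k,k+1}=n-k$, $Q_{kk}=-n$, all other entries zero. It is reversible with respect to $\nu_k=2^{-n}\binom nk$. With $P=\mathrm{I}+\tfrac1n Q$ and $D=\mathrm{diag}(\sqrt{\nu_0},\dots,\sqrt{\nu_n})$, set $A_{\mathrm{sym}}:=DPD^{-1}$ (real symmetric). The standard basis of $\mathbb{C}^{n+1}$ is labelled either by $k\in\{0,\dots,n\}$ or by $m=k-\tfrac n2$; $|k\rangle$ and $|m\rangle$ then denote the same vector. Spin-$\tfrac n2$ matrices in this basis: $J_z|k\rangle=(k-\tfrac n2)|k\rangle$; $J_x$ is real symmetric tridiagonal with zero diagonal and $(J_x)_{k+1,k}=\tfrac12\sqrt{(k+1)(n-k)}$; $J_y$ is Hermitian tridiagonal with zero diagonal and $(J_y)_{k+1,k}=-i(J_x)_{k+1,k}$, $(J_y)_{k,k+1}=i(J_x)_{k,k+1}$, so that $[J_x,J_y]=iJ_z$ and cyclically. ''Up to a column phase'' means that each $u_m$ is determined only up to an overall unimodular factor (a sign for real vectors). *)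

(* Defs.v *)
From HB Require Import structures.
From mathcomp Require Import all_boot all_order all_algebra.
From mathcomp Require Import complex.
From mathcomp Require Import all_classical all_reals all_analysis.
Import Order.TTheory GRing.Theory Num.Theory.
Import numFieldNormedType.Exports.

Set Implicit Arguments.
Unset Strict Implicit.
Unset Printing Implicit Defensive.

Local Open Scope ring_scope.

(* The limit is taken in the library's norm topology on matrices; it is used
   below with K the reals or the complex numbers, where the series always
   converges. *)
Definition expmx (K : numFieldType) (n : nat) (A : 'M[K]_n.+1) : 'M[K]_n.+1 :=
  limn (series (fun i : nat => i`!%:R^-1 *: A ^+ i)).

(* The half-integer labels m = -n/2, ..., n/2 are encoded by j = m + n/2 in
   'I_n.+1, so that |k> and |m> are columns of the same standard basis. *)
Definition spin (R : realType) (n : nat) (j : 'I_n.+1) : R :=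
  j%:R - n%:R / 2%:R.

Section Ehrenfest.
Variables (R : realType) (n : nat).

Definition ehrenfestQ : 'M[R]_n.+1 :=
  \matrix_(k, l)
    (if k == l.+1 :> nat then k%:R
     else if l == k.+1 :> nat then n%:R - k%:R
     else if k == l then - n%:R
     else 0).

Definition nu (k : 'I_n.+1) : R := 2%:R ^- n * 'C(n, k)%:R.

Definition ehrenfestP : 'M[R]_n.+1 := 1%:M + n%:R^-1 *: ehrenfestQ.

Definition gaugeD : 'M[R]_n.+1 := diag_mx (\row_k Num.sqrt (nu k)).

Definition Asym : 'M[R]_n.+1 := gaugeD *m ehrenfestP *m invmx gaugeD.

Definition sym_eigenbasis (u : 'I_n.+1 -> 'cV[R]_n.+1) : Prop :=
  (forall j, Asym *m u j = (2%:R * spin R j / n%:R) *: u j) /\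
  (forall i j, ((u i)^T *m u j) 0 0 = (i == j)%:R).

Definition rescaled (u : 'I_n.+1 -> 'cV[R]_n.+1) (j k : 'I_n.+1) : R :=
  u j k 0 / Num.sqrt (nu k).

End Ehrenfest.

Section Spin.
Variables (R : realType) (n : nat).
Local Open Scope complex_scope.

Definition Jz : 'M[R[i]]_n.+1 := diag_mx (\row_k (spin R k)%:C).

Definition Jx : 'M[R[i]]_n.+1 :=
  \matrix_(k, l)
    (if k == l.+1 :> nat then
       (Num.sqrt ((l%:R + 1) * (n%:R - l%:R)) / 2%:R : R)%:C
     else if l == k.+1 :> nat then
       (Num.sqrt ((k%:R + 1) * (n%:R - k%:R)) / 2%:R : R)%:C
     else 0).

Definition Jy : 'M[R[i]]_n.+1 :=
  \matrix_(k, l)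
    (if k == l.+1 :> nat then - 'i * Jx k l
     else if l == k.+1 :> nat then 'i * Jx k l
     else 0).

Definition rotation_y (theta : R) : 'M[R[i]]_n.+1 :=
  expmx (- 'i * theta%:C *: Jy).

Lemma Jz_ket (k : 'I_n.+1) :
  Jz *m (delta_mx k 0 : 'cV_n.+1) = (spin R k)%:C *: delta_mx k 0.
Proof.
apply/matrixP => a b; rewrite /Jz mul_diag_mx !mxE.
by have [->|] := eqVneq a k; rewrite //= !mulr0.
Qed.

End Spin.

Section Krawtchouk.
Variables (R : realType).

Definition binom_poly (p : {poly R}) (i : nat) : {poly R} :=
  i`!%:R^-1 *: \prod_(l < i) (p - l%:R%:P).

(* The symmetric (parameter 1/2) Krawtchouk polynomial of degree d, that is
   x |-> \sum_i (-1)^i C(x, i) C(n - x, d - i). *)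
Definition krawtchouk (n d : nat) : {poly R} :=
  \sum_(i < d.+1)
    (-1) ^+ i *: (binom_poly 'X i * binom_poly (n%:R%:P - 'X) (d - i)).

(* The squared norm of [krawtchouk n d] in L^2(nu) is C(n, d). *)
Definition norm_krawtchouk (n d : nat) : {poly R} :=
  (Num.sqrt 'C(n, d)%:R)^-1 *: krawtchouk n d.

End Krawtchouk.

(* Main.v *)
Require Import Defs.
From mathcomp Require Import all_boot all_order all_algebra.
From mathcomp Require Import ring zify.
From mathcomp Require Import complex.
From mathcomp Require Import all_classical all_reals all_analysis.
Import Order.TTheory GRing.Theory Num.Theory.
Import numFieldNormedType.Exports.

(** The urn is a spin in disguise. The invariant weight satisfies detailed
    balance, so conjugation by the square roots of the weights turns the
    generator [Q] into the symmetric matrix [2 Jx - n] ([real_Jx_similar]),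
    and [Asym] into [2 / n] times [Jx] ([Asym_real_Jx]). Everything thus
    reduces to the diagonalisation of [Jx].

    The values of the Krawtchouk polynomials at [k] are the coefficients of
    (1 - x)^k (1 + x)^(n - k). A differential identity for these polynomials
    says that the Krawtchouk polynomial of degree [d] is an eigenfunction of
    the urn ([kraw_gen_step]); the fact that x |-> (1 - x) / (1 + x) is an
    involution says that the matrix of values squares to 2^n
    ([kraw_gen_invol]); the symmetry of a multinomial coefficient exchanges
    degree and argument ([kraw_gen_dual]). Normalised, these values form a
    real matrix [kraw_mx], the symmetric power of the Hadamard matrix, which
    is symmetric, is its own inverse and exchanges [Jx] with [- Jz]. Its
    columns are therefore an orthonormal eigenbasis, and the spectrum of
    [Jx] being simple, any other real one agrees with it up to signs
    ([sym_eigenbasis_unique]). The degree [n - j] belongs to the eigenvalue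
    [j - n / 2], whence the order reversal [rev_ord] throughout. The
    Krawtchouk form of the eigenvectors, their orthogonality and the
    spectral form of the semigroup follow.

    For the rotation, let E be the diagonal matrix with entries (-i)^k and M
    the matrix [kraw_mx]. Then [Jy] is E Jx E^-1, so -E M Jz M E^-1, and the
    exponential of -i (pi / 2) Jy is computed on the diagonal: it is a
    unimodular scalar times E M E^-1 M E^-1 ([rotation_yE]). This unitary
    matrix intertwines [Jz] with [Jx] ([rot_pihalf_Jx]), so its columns are
    eigenvectors of [Jx]; they are real as limits of real partial sums
    ([rot_pihalf_real]), and a real unit vector on the line spanned by a
    real unit vector is that vector up to sign ([rot_pihalf_col]). *)

Set Implicit Arguments.
Unset Strict Implicit.
Unset Printing Implicit Defensive.

Local Open Scope ring_scope.

(** * Krawtchouk values as coefficients of (1 - x)^k (1 + x)^(n - k) *)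

Section GeneratingPolynomial.
Variable K : comNzRingType.
Implicit Types (n d k m : nat) (p q a b : {poly K}) (c : K).

(** The generating polynomial of the Krawtchouk values: its coefficient of
    ['X^d] is the value at [k] of the Krawtchouk polynomial of degree [d]. *)
Definition kraw_gen n k : {poly K} :=
  (1 - 'X) ^+ k * (1 + 'X) ^+ (n - k).

Lemma coef_1DcXM c p i :
  ((1 + c *: 'X) * p)`_i.+1 = p`_i.+1 + c * p`_i.
Proof. by rewrite mulrDl mul1r coefD -scalerAl coefZ coefXM. Qed.

Lemma coef_1DcXM0 c p : ((1 + c *: 'X) * p)`_0 = p`_0.
Proof. by rewrite mulrDl mul1r coefD -scalerAl coefZ coefXM mulr0 addr0. Qed.

Lemma coef_1DcXn c m i :
  ((1 + c *: 'X) ^+ m : {poly K})`_i = c ^+ i * 'C(m, i)%:R.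
Proof.
elim: m i => [|m IHm] [|i].
- by rewrite !expr0 coefC bin0 mulr1.
- by rewrite expr0 coefC bin0n mulr0.
- by rewrite exprS coef_1DcXM0 IHm !bin0.
by rewrite exprS coef_1DcXM !IHm binS natrD exprS; ring.
Qed.

Lemma size_1DcXM c p m : (size p <= m)%N ->
  (size ((1 + c *: 'X) * p)%R <= m.+1)%N.
Proof.
move=> szp; apply/leq_sizeP => -[|i] //; rewrite ltnS => le_mi.
rewrite coef_1DcXM !nth_default ?mulr0 ?addr0 //; apply: leq_trans szp _ => //.
exact: leqW.
Qed.

Lemma onemX : 1 - 'X = 1 + (-1) *: 'X :> {poly K}.
Proof. by rewrite scaleN1r. Qed.

Lemma onepX : 1 + 'X = 1 + 1 *: 'X :> {poly K}.
Proof. by rewrite scale1r. Qed.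

(** Writing [p] as a polynomial in [a / b] and clearing denominators by
    [b ^+ n]: this lets one substitute a fraction into [p] without leaving
    the ring. *)
Definition homog n a b p : {poly K} :=
  \sum_(d < n.+1) p`_d *: (a ^+ d * b ^+ (n - d)).

(** A linear factor becomes a linear form, so homogenisation is
    multiplicative on products of linear factors, as is [kraw_gen]. *)
Lemma homog_1DcXM n a b p c : (size p <= n.+1)%N ->
  homog n.+1 a b ((1 + c *: 'X) * p) = (b + c *: a) * homog n a b p.
Proof.
move=> szp; rewrite /homog [RHS]mulrDl.
under eq_bigr => d _ do
  rewrite mulrDl mul1r coefD scalerDl -scalerAl coefZ coefXM.
rewrite big_split /=; congr (_ + _).
  rewrite big_ord_recr /= nth_default // scale0r addr0 big_distrr /=.
  apply: eq_bigr => d _; rewrite -scalerAr mulrCA -exprS subSn //.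
  by rewrite -ltnS.
rewrite big_ord_recl /= mulr0 scale0r add0r big_distrr /=.
apply: eq_bigr => d _.
by rewrite -scalerA -scalerAl -scalerAr exprS subSS mulrA.
Qed.

Lemma homog_kraw_gen n k a b : (k <= n)%N ->
  (size (kraw_gen n k) <= n.+1)%N /\
  homog n a b (kraw_gen n k) = (b - a) ^+ k * (b + a) ^+ (n - k).
Proof.
rewrite /kraw_gen onemX onepX => /subnKC; move: (n - k)%N => m <-.
elim: k => [|k [szk IHk]].
  rewrite expr0 mul1r add0n; elim: m => [|m [szm IHm]].
    by rewrite !expr0 size_poly1 /homog big_ord1 coefC /= scale1r !expr0 !mulr1.
  rewrite !exprS; split; first exact: size_1DcXM.
  by rewrite homog_1DcXM // IHm scale1r; ring.
rewrite exprS -mulrA; split; first exact: size_1DcXM.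
by rewrite homog_1DcXM // IHk scaleN1r exprS -mulrA.
Qed.

(** The map x |-> (1 - x) / (1 + x) is an involution. Substituted into
    [kraw_gen n k] it gives, after clearing denominators, (2 x)^k 2^(n - k),
    while expanding first gives the sum on the left. *)
Lemma kraw_gen_invol n k l : (k <= n)%N ->
  \sum_(d < n.+1) (kraw_gen n k)`_d * (kraw_gen n d)`_l
    = 2 ^+ n * (k == l)%:R.
Proof.
move=> le_kn; have [_ /(congr1 (fun p : {poly K} => p`_l))] :=
  homog_kraw_gen (1 - 'X) (1 + 'X) le_kn.
rewrite /homog coef_sum => eqG; transitivity
  (\sum_(d < n.+1) (kraw_gen n k)`_d *: kraw_gen n d)`_l.
  by rewrite coef_sum; apply: eq_bigr => d _; rewrite coefZ.
rewrite coef_sum eqG.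
have -> : 1 + 'X - (1 - 'X) = 2%:P * 'X :> {poly K} by rewrite polyC_natr; ring.
have -> : 1 + 'X + (1 - 'X) = 2%:P :> {poly K} by rewrite polyC_natr; ring.
rewrite exprMn -mulrA [_ * (_ ^+ (n - k))]mulrC mulrA -exprD subnKC //.
by rewrite -rmorphXn coefCM coefXn eq_sym.
Qed.

Lemma coef_kraw_gen n k d : (kraw_gen n k)`_d =
  \sum_(i < d.+1) (-1) ^+ i * 'C(k, i)%:R * 'C(n - k, d - i)%:R.
Proof.
rewrite /kraw_gen coefM; apply: eq_bigr => i _.
by rewrite onemX onepX !coef_1DcXn expr1n mul1r.
Qed.

(** This is the identity k G_(k-1) + (n - k) G_(k+1) = n G_k - 2 x G_k' for
    the generating polynomials G_k, read off at x^d; it makes the Krawtchouk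
    polynomials eigenfunctions of the urn. At the two ends the factors [k]
    and [n - k] vanish, which covers the absent neighbours. *)
Lemma kraw_gen_step n k d : (k <= n)%N ->
  k%:R * (kraw_gen n k.-1)`_d + (n%:R - k%:R) * (kraw_gen n k.+1)`_d
    = (n%:R - 2 * d%:R) * (kraw_gen n k)`_d.
Proof.
move=> le_kn.
have coefXd p : d%:R * p`_d = ('X * p^`())`_d.
  by case: d => [|e]; rewrite coefXM ?mul0r // coef_deriv mulr_natl.
rewrite [RHS]mulrBl -[2 * _ * _]mulrA coefXd -natrB // !mulr_natl.
rewrite -!coefMn -coefD -coefB; congr (polyseq _)`_d.
rewrite /kraw_gen derivM !deriv_exp derivB derivD derivX derivC.
move: le_kn => /subnKC; rewrite subnS; move: (n - k)%N => m <-.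
case: k m => [|k] [|m]; rewrite ?addKn ?addn0 ?add0n ?subn0 ?subnn /=.
- by rewrite !expr0; ring.
- rewrite !exprS !expr0; move: (_ ^+ m) => v; ring.
- rewrite subSn // subnn !exprS !expr0; move: (_ ^+ k) => v; ring.
- rewrite addSnnS addKn !exprS; move: (_ ^+ m) (_ ^+ k) => v u; ring.
Qed.
End GeneratingPolynomial.

Lemma trinomial_fact i a b c :
  ('C(i + a + b + c, i + a) * 'C(i + a, i) * 'C(b + c, b)
      * (i`! * a`! * b`! * c`!)
    = (i + a + b + c)`!)%N.
Proof.
have E (m p : nat) : ('C(m + p, m) * (m`! * p`!) = (m + p)`!)%N.
  by rewrite -[X in (_ * (_ * X`!))%N](addKn m p) bin_fact ?leq_addr.
have := E (i + a)%N (b + c)%N; have := E i a; have := E b c.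
rewrite addnA => <- <- <-; lia.
Qed.

(** Both sides are the multinomial coefficient n! / (i! (k - i)! (d - i)! (n
    - k - d + i)!), which is symmetric in [k] and [d]. *)
Lemma trinomialC n k d i : (i <= k)%N -> (i <= d)%N ->
  ('C(n, k) * 'C(k, i) * 'C(n - k, d - i) =
   'C(n, d) * 'C(d, i) * 'C(n - d, k - i))%N.
Proof.
move=> /subnKC <- /subnKC <-.
move: (k - i)%N (d - i)%N => {k d} a b; rewrite !addKn.
have [le_n|lt_n] := leqP (i + a + b) n; last first.
  have small (x y : nat) : (n < i + x + y)%N ->
      ('C(n, i + x) * 'C(i + x, i) * 'C(n - (i + x), y) = 0)%N.
    move=> lt_n'; have [le_x|lt_x] := leqP (i + x) n; last by rewrite bin_small.
    by rewrite [X in (_ * X)%N]bin_small ?muln0 // ltn_subLR.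
  by rewrite !small // addnAC.
rewrite -(subnKC le_n); move: (n - _)%N => {n le_n} c.
have fact_prod_gt0 : (0 < i`! * a`! * b`! * c`!)%N.
  by rewrite !muln_gt0 !fact_gt0.
apply/eqP; rewrite -(eqn_pmul2r fact_prod_gt0).
rewrite -[X in 'C(X - (i + a), _)]addnA addKn trinomial_fact.
rewrite [(i + a + b)%N]addnAC -[X in 'C(X - (i + b), _)]addnA addKn.
by rewrite [(i`! * a`! * _)%N]mulnAC trinomial_fact.
Qed.

Section Duality.
Variable K : comNzRingType.

(** Self-duality: after multiplication by the weight, each term of the sum
    for a Krawtchouk value is symmetric in the degree and the argument. *)
Lemma kraw_gen_dual n k d : (k <= n)%N -> (d <= n)%N ->
  'C(n, k)%:R * (kraw_gen K n k)`_d = 'C(n, d)%:R * (kraw_gen K n d)`_k.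
Proof.
(* The sum over [i <= b] is cut down to [i <= a], where the binomials do not
   vanish, and reindexed over a range that does not depend on [a] and [b]. *)
have widen a b : (a <= n)%N -> (b <= n)%N ->
    'C(n, a)%:R * (kraw_gen K n a)`_b =
    \sum_(i < n.+1 | (i <= a)%N && (i <= b)%N)
      (-1) ^+ i * ('C(n, a) * 'C(a, i) * 'C(n - a, b - i))%:R.
  move=> le_an le_bn; rewrite coef_kraw_gen big_distrr /=.
  rewrite (big_ord_widen n.+1 (fun i => 'C(n, a)%:R *
    ((-1) ^+ i * 'C(a, i)%:R * 'C(n - a, b - i)%:R))) ?ltnS //.
  rewrite big_mkcond [RHS]big_mkcond; apply: eq_bigr => i _; rewrite ltnS.
  case: (leqP i b) => _; rewrite ?andbF ?andbT //.
  case: leqP => [_|lt_ai]; first by rewrite !natrM; ring.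
  by rewrite (@bin_small a) // mulr0n mulr0 mul0r mulr0.
move=> le_kn le_dn; rewrite !widen //.
rewrite (eq_bigl (fun i : 'I_n.+1 => (i <= d)%N && (i <= k)%N)); last first.
  by move=> i; rewrite andbC.
by apply: eq_bigr => i /andP[le_id le_ik]; rewrite trinomialC.
Qed.

End Duality.

(** * The Krawtchouk polynomials *)

Section Krawtchouk.
Variable R : realType.

Lemma horner_binom_poly (p : {poly R}) (x : R) m i : p.[x] = m%:R ->
  (binom_poly p i).[x] = 'C(m, i)%:R.
Proof.
move=> px; rewrite /binom_poly hornerZ.
have -> : (\prod_(l < i) (p - l%:R%:P)).[x] = (m ^_ i)%:R.
  elim: i => [|i IHi]; first by rewrite big_ord0 hornerC ffactn0.
  rewrite big_ord_recr /= hornerM IHi !hornerE px ffactnSr natrM.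
  have [le_im|lt_mi] := leqP i m; first by rewrite natrB.
  by rewrite ffact_small // !mul0r.
by rewrite -bin_ffact natrM mulrCA mulVf ?mulr1 // pnatr_eq0 -lt0n fact_gt0.
Qed.

Lemma horner_krawtchouk n k d : (k <= n)%N ->
  (krawtchouk R n d).[k%:R] = (kraw_gen R n k)`_d.
Proof.
move=> le_kn; rewrite coef_kraw_gen /krawtchouk horner_sum.
apply: eq_bigr => i _.
rewrite hornerZ hornerM (@horner_binom_poly _ _ k) ?hornerX //.
by rewrite (@horner_binom_poly _ _ (n - k)) ?mulrA // !hornerE natrB.
Qed.

Lemma size_lead_binom_poly (p : {poly R}) i : (size p = 2)%N ->
  size (binom_poly p i) = i.+1 /\
  lead_coef (binom_poly p i) = lead_coef p ^+ i / i`!%:R.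
Proof.
move=> szp.
have fact_neq0 : i`!%:R^-1 != 0 :> R.
  by rewrite invr_eq0 pnatr_eq0 -lt0n fact_gt0.
have szpc c : size (p - c%:P) = 2%N /\ lead_coef (p - c%:P) = lead_coef p.
  have szc : (size (- c%:P) < size p)%N.
    by rewrite szp ltnS size_polyN size_polyC; case: (c != 0).
  by rewrite size_polyDl // lead_coefDl.
rewrite /binom_poly size_scale // lead_coefZ [_ / _]mulrC.
suff [-> ->] : size (\prod_(l < i) (p - l%:R%:P)) = i.+1 /\
    lead_coef (\prod_(l < i) (p - l%:R%:P)) = lead_coef p ^+ i by [].
split; last first.
  rewrite lead_coef_prod (eq_bigr (fun=> lead_coef p)) ?prodr_const ?card_ord //.
  by move=> l _; case: (szpc l%:R).
rewrite size_prod => [|l _]; last by rewrite -size_poly_eq0 (proj1 (szpc _)).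
rewrite (eq_bigr (fun=> 2%N)) => [|l _]; last exact: (proj1 (szpc _)).
by rewrite sum_nat_const !card_ord; lia.
Qed.

(** Every summand has degree [d]. The alternating signs of the sum combine
    with those of the leading coefficients into a common sign, so that these
    add up to (-2)^d / d!, which is not zero. *)
Lemma size_krawtchouk n d : size (krawtchouk R n d) = d.+1.
Proof.
set F := fun i =>
  binom_poly 'X i * binom_poly (n%:R%:P - 'X) (d - i) : {poly R}.
have szN : size (n%:R%:P - 'X : {poly R}) = 2%N.
  by rewrite -opprB size_polyN size_XsubC.
have leadN : lead_coef (n%:R%:P - 'X : {poly R}) = -1.
  by rewrite -opprB lead_coefN lead_coefXsubC.
have fact_neq0 i : i`!%:R != 0 :> R by rewrite pnatr_eq0 -lt0n fact_gt0.
have [szX leadX] : (forall i, size (binom_poly 'X i : {poly R}) = i.+1) /\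
    (forall i, lead_coef (binom_poly 'X i : {poly R}) = i`!%:R^-1).
  split=> i; have [] := @size_lead_binom_poly 'X i (size_polyX _) => // _.
  by rewrite lead_coefX expr1n mul1r.
have szF i : (i <= d)%N -> size (F i) = d.+1.
  have szB := proj1 (size_lead_binom_poly _ szN).
  by move=> le_id; rewrite size_mul -?size_poly_eq0 ?szX ?szB //; lia.
have coefF i : (i <= d)%N -> (F i)`_d = (-1) ^+ (d - i) * 'C(d, i)%:R / d`!%:R.
  move=> le_id; have -> : (F i)`_d = lead_coef (F i) by rewrite lead_coefE szF.
  rewrite lead_coefM leadX (proj2 (size_lead_binom_poly _ szN)) leadN.
  rewrite -(bin_fact le_id) !natrM; field.
  by rewrite !fact_neq0 pnatr_eq0 -lt0n bin_gt0 le_id.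
have coefd : (krawtchouk R n d)`_d = (-2) ^+ d / d`!%:R.
  rewrite /krawtchouk coef_sum.
  rewrite (_ : -2 = -1 - 1) ?exprDn ?mulr_suml; last by ring.
  apply: eq_bigr => i _; rewrite coefZ -/(F i) coefF; last by rewrite -ltnS.
  by rewrite -mulr_natr; ring.
apply/eqP; rewrite eqn_leq; apply/andP; split.
  rewrite (leq_trans (size_sum _ _ _)) //; apply/bigmax_leqP => i _.
  by rewrite (leq_trans (size_scale_leq _ _)) // szF // -ltnS ltn_ord.
rewrite ltnNge; apply/negP => /leq_sizeP/(_ d (leqnn d)) /eqP.
rewrite coefd mulf_eq0 invr_eq0 (negPf (fact_neq0 d)) orbF expf_eq0 oppr_eq0.
by rewrite pnatr_eq0 andbF.
Qed.
End Krawtchouk.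

(** * The symmetrised chain and the Krawtchouk matrix *)

Section RealMatrices.
Variables (R : realType) (n : nat).

Let le_ord (k : 'I_n.+1) : (k <= n)%N.
Proof. by rewrite -ltnS. Qed.

Lemma nu_gt0 (k : 'I_n.+1) : 0 < nu R k.
Proof. by rewrite mulr_gt0 ?invr_gt0 ?exprn_gt0 // ltr0n bin_gt0. Qed.

Lemma sqrt_nu_neq0 (k : 'I_n.+1) : Num.sqrt (nu R k) != 0.
Proof. by rewrite sqrtr_eq0 -ltNge nu_gt0. Qed.

(** Functions of a natural number are used so that the neighbours of the end
    points, which carry rate zero, need no case distinction. *)
Lemma sum_ehrenfestQ (F : nat -> R) (k : 'I_n.+1) :
  \sum_(l < n.+1) ehrenfestQ R n k l * F l =
  k%:R * F k.-1 + (n%:R - k%:R) * F k.+1 - n%:R * F k.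
Proof.
have Q_split (l : 'I_n.+1) : ehrenfestQ R n k l * F l =
    (if l.+1 == k then k%:R * F l else 0) +
    (if l == k.+1 :> nat then (n%:R - k%:R) * F l else 0) +
    (if l == k then - n%:R * F l else 0).
  rewrite mxE [k == l.+1 :> nat]eq_sym [k == l]eq_sym.
  have [Ekl|_] := eqVneq l.+1 (k : nat).
    have -> : (l == k.+1 :> nat) = false by lia.
    by rewrite (_ : (l == k) = false) ?addr0 // -val_eqE /=; lia.
  have [Elk|_] := eqVneq (l : nat) k.+1; last first.
    by rewrite !add0r; case: eqP; rewrite ?mul0r.
  by rewrite -val_eqE /= Elk gtn_eqF // add0r addr0.
under eq_bigr => l _ do rewrite Q_split.
rewrite !big_split /= -!big_mkcond /= big_pred1_eq mulNr; congr (_ + _ - _).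
  case: k {Q_split} => -[|k] lt_k /=.
    by rewrite big1 ?mul0r // => l /eqP.
  by rewrite (big_pred1 (Ordinal (ltnW lt_k))) // => l; rewrite -val_eqE.
have [lt_k|le_nk] := ltnP k n.
  by rewrite (big_pred1 (Ordinal (lt_k : (k.+1 < n.+1)%N))) // => l;
     rewrite -val_eqE.
have -> : k = n :> nat by apply/eqP; rewrite eqn_leq -ltnS ltn_ord.
by rewrite subrr mul0r big1 // => l /eqP El; have := ltn_ord l; rewrite El ltnn.
Qed.

Definition real_Jx : 'M[R]_n.+1 :=
  \matrix_(k, l)
    (if k == l.+1 :> nat then Num.sqrt ((l%:R + 1) * (n%:R - l%:R)) / 2%:R
     else if l == k.+1 :> nat then Num.sqrt ((k%:R + 1) * (n%:R - k%:R)) / 2%:R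
     else 0).

Definition real_Jz : 'M[R]_n.+1 := diag_mx (\row_k spin R k).

(** Detailed balance: conjugating the generator by the square roots of the
    invariant weights replaces the two rates [k + 1] and [n - k] across an
    edge by their geometric mean, which is the entry of [Jx] up to the
    factor 2. *)
Lemma real_Jx_gauge (k l : 'I_n.+1) : real_Jx k l * Num.sqrt (nu R l) =
  Num.sqrt (nu R k) * ((ehrenfestQ R n k l + n%:R * (k == l)%:R) / 2).
Proof.
have nuS (i j : 'I_n.+1) : i = j.+1 :> nat ->
    nu R i * i%:R = nu R j * (n%:R - j%:R).
  move=> Eij; have le_jn : (j <= n)%N by rewrite -ltnS.
  rewrite /nu -!mulrA Eij -natrB // -!natrM.
  by rewrite mulnC mul_bin_left mulnC.
(* With [a] and [b] the two rates across an edge, and [x], [y] the weights. *)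
have balance (x y a b : R) : 0 <= x -> 0 <= a -> 0 <= b -> x * a = y * b ->
    Num.sqrt (a * b) * Num.sqrt y = Num.sqrt x * a.
  move=> x0 a0 b0 xy; rewrite -sqrtrM ?mulr_ge0 //.
  rewrite -mulrA [b * y]mulrC -xy mulrCA -expr2 sqrtrM //.
  by rewrite sqrtr_sqr ger0_norm.
have nu0 (i : 'I_n.+1) : 0 <= nu R i by exact/ltW/nu_gt0.
have nB0 (i : 'I_n.+1) : 0 <= n%:R - i%:R :> R by rewrite subr_ge0 ler_nat.
rewrite !mxE; case: eqVneq => [Ekl|ne1].
  have -> : (k == l) = false by rewrite -val_eqE /= Ekl gtn_eqF.
  rewrite mulr0 addr0 mulrAC mulrA; congr (_ / _).
  by rewrite natr1 -Ekl; apply: balance => //; exact: nuS.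
case: eqVneq => [Elk|ne2].
  have -> : (k == l) = false by rewrite -val_eqE /= Elk ltn_eqF.
  rewrite mulr0 addr0 mulrAC mulrA; congr (_ / _).
  rewrite natr1 -Elk mulrC [_%:R * _]mulrC; rewrite mulrC.
  by apply: balance => //; rewrite (nuS _ _ Elk).
rewrite mul0r; case: eqVneq => _; first by rewrite mulr1 addNr mul0r mulr0.
by rewrite mulr0 addr0 mul0r mulr0.
Qed.

(** The n-th symmetric power of the Hadamard matrix, in the normalised
    basis. Column [d] is the normalised Krawtchouk polynomial of degree [d]
    times the square root of the weight. *)
Definition kraw_mx : 'M[R]_n.+1 :=
  \matrix_(k, d) ((Num.sqrt (2 ^+ n))^-1 * Num.sqrt (nu R k) *
                  (kraw_gen R n k)`_d / Num.sqrt (nu R d)).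

Lemma kraw_mx_invol : kraw_mx *m kraw_mx = 1%:M.
Proof.
apply/matrixP => k l; rewrite !mxE.
have s0 : Num.sqrt (2 ^+ n) != 0 :> R by rewrite sqrtr_eq0 -ltNge exprn_gt0.
have ss : 2 ^+ n = Num.sqrt (2 ^+ n) ^+ 2 :> R by rewrite sqr_sqrtr ?exprn_ge0.
transitivity (\sum_(d < n.+1)
    (2 ^+ n)^-1 * Num.sqrt (nu R k) / Num.sqrt (nu R l) *
    ((kraw_gen R n k)`_d * (kraw_gen R n d)`_l)).
  apply: eq_bigr => d _; rewrite !mxE [in (2 ^+ n)^-1]ss.
  move: (Num.sqrt (2 ^+ n)) s0 => s s0.
  by field; rewrite !sqrt_nu_neq0 s0.
rewrite -mulr_sumr kraw_gen_invol // val_eqE.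
case: eqP => [->|_]; last by rewrite !mulr0.
by field; rewrite sqrt_nu_neq0 expf_neq0 // pnatr_eq0.
Qed.

Lemma kraw_mx_sym : kraw_mx^T = kraw_mx.
Proof.
apply/matrixP => d k; rewrite !mxE.
have dual := kraw_gen_dual R (le_ord k) (le_ord d).
have nu_dual : nu R k * (kraw_gen R n k)`_d = nu R d * (kraw_gen R n d)`_k.
  by rewrite /nu -!mulrA dual.
apply: (mulIf (sqrt_nu_neq0 d)); rewrite divfK ?sqrt_nu_neq0 //.
apply: (mulIf (sqrt_nu_neq0 k)).
rewrite -[LHS]mulrA -[_ * _ * Num.sqrt (nu R k)]mulrA.
have sq (i : 'I_n.+1) : Num.sqrt (nu R i) * Num.sqrt (nu R i) = nu R i.
  by rewrite -expr2 sqr_sqrtr // ltW ?nu_gt0.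
transitivity ((Num.sqrt (2 ^+ n))^-1 * (nu R k * (kraw_gen R n k)`_d)).
  by rewrite -[in RHS](sq k); ring.
rewrite nu_dual -[in LHS](sq d); field.
by rewrite sqrt_nu_neq0 sqrtr_eq0 -ltNge exprn_gt0.
Qed.

(** Column [d] is an eigenvector with eigenvalue [n / 2 - d], the opposite
    of the [d]-th entry of [real_Jz]: degrees count down from the top of the
    spectrum. *)
Lemma real_Jx_kraw_mx : real_Jx *m kraw_mx = - (kraw_mx *m real_Jz).
Proof.
apply/matrixP => k d; rewrite mul_mx_diag !mxE.
transitivity ((Num.sqrt (2 ^+ n))^-1 * Num.sqrt (nu R k) / Num.sqrt (nu R d) *
   \sum_(l < n.+1) (ehrenfestQ R n k l * (kraw_gen R n l)`_d +
      n%:R * ((k == l)%:R * (kraw_gen R n l)`_d)) / 2).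
  rewrite mulr_sumr; apply: eq_bigr => l _.
  rewrite [kraw_mx _ _]mxE.
  rewrite (_ : real_Jx k l * _ =
     (Num.sqrt (2 ^+ n))^-1 * (real_Jx k l * Num.sqrt (nu R l)) *
     (kraw_gen R n l)`_d / Num.sqrt (nu R d)); last by ring.
  rewrite real_Jx_gauge; ring.
(* The sum is now that of (Q + n) / 2 against the Krawtchouk values. *)
rewrite -mulr_suml big_split /= (sum_ehrenfestQ (fun l => (kraw_gen R n l)`_d)).
rewrite -mulr_sumr (bigD1 k) //= eqxx mul1r big1 ?addr0; last first.
  by move=> l ne_lk; rewrite eq_sym (negPf ne_lk) mul0r.
rewrite subrK kraw_gen_step // /spin; field.
by rewrite sqrt_nu_neq0 sqrtr_eq0 -ltNge exprn_gt0.
Qed.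

Lemma gauge_unit : gaugeD R n \in unitmx.
Proof.
rewrite unitmxE det_diag unitfE; apply/prodf_neq0 => k _.
by rewrite mxE sqrt_nu_neq0.
Qed.

Lemma real_Jx_similar :
  real_Jx *m gaugeD R n = gaugeD R n *m (2^-1 *: (ehrenfestQ R n + n%:R%:M)).
Proof.
apply/matrixP => k l; rewrite mul_diag_mx mul_mx_diag !mxE -/(nu R l).
have := real_Jx_gauge k l; rewrite !mxE => ->.
by rewrite mulr_natr [_ / 2]mulrC.
Qed.

Lemma Asym_real_Jx : (0 < n)%N -> Asym R n = (2 / n%:R) *: real_Jx.
Proof.
move=> n_gt0; rewrite /Asym -[RHS](mulmxK gauge_unit); congr (_ *m _).
rewrite -scalemxAl real_Jx_similar -scalemxAr scalerA /ehrenfestP.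
have n_neq0 : n%:R != 0 :> R by rewrite pnatr_eq0 -lt0n.
rewrite scalemxAr; congr (_ *m _).
rewrite scalerDr scale_scalar_mx addrC; congr (_ *: _ + _%:M); field.
  exact: n_neq0.
exact: n_neq0.
Qed.

(** The generator is [2 Jx - n] up to the gauge, and [Jx] is diagonalised by
    the Krawtchouk matrix with eigenvalues [n / 2 - d]. *)
Lemma ehrenfestQ_spectral : ehrenfestQ R n =
  invmx (gaugeD R n) *m kraw_mx *m diag_mx (\row_d (- 2 * d%:R)) *m
    (kraw_mx *m gaugeD R n).
Proof.
apply: (can_inj (mulKmx gauge_unit)).
rewrite !mulmxA mulmxV ?gauge_unit // mul1mx.
have -> : diag_mx (\row_d (- 2 * d%:R)) = - 2 *: real_Jz - n%:R%:M :> 'M[R]_n.+1.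
  apply/matrixP => i j; rewrite !mxE /spin.
  by case: (i == j); rewrite ?mulr1n ?mulr0n; field.
rewrite mulmxBr mul_mx_scalar -scalemxAr mulmxBl -!scalemxAl.
rewrite mulmxBl -!scalemxAl kraw_mx_invol mul1mx.
have -> : kraw_mx *m real_Jz *m kraw_mx = - real_Jx.
  rewrite -[kraw_mx *m real_Jz]opprK -real_Jx_kraw_mx mulNmx -mulmxA.
  by rewrite kraw_mx_invol mulmx1.
rewrite mulNmx real_Jx_similar -scalemxAr mulmxDr mul_mx_scalar scaleNr scalerN.
by rewrite opprK scalerA divff ?pnatr_eq0 // scale1r addrK.
Qed.

End RealMatrices.

Lemma Jx_map (R : realType) n : Jx R n = map_mx (real_complex R) (real_Jx R n).
Proof. by apply/matrixP => k l; rewrite !mxE; do 2?case: ifP => _. Qed.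

Lemma Jz_map (R : realType) n : Jz R n = map_mx (real_complex R) (real_Jz R n).
Proof.
apply/matrixP => k l; rewrite !mxE.
by case: (k == l); rewrite ?mulr1n ?mulr0n.
Qed.

(** * Exponentials of diagonalizable matrices *)

Section MatrixExponential.
Local Open Scope classical_set_scope.
Variable K : numFieldType.

Lemma cvg_mx_entries n (S : nat -> 'M[K]_n.+1) (L : 'M[K]_n.+1) :
  (forall i j, (fun k => S k i j) @ \oo --> L i j) -> S @ \oo --> L.
Proof.
move=> entryL; apply/cvg_ballP => e e0.
have near_entries : \forall k \near \oo, forall i j, ball (L i j) e (S k i j).
  apply: filter_forall => i; apply: filter_forall => j.
  by move/cvg_ballP: (entryL i j); apply.
by near=> k; split=> //; near: k.
Unshelve. all: by end_near. Qed.

Lemma cvg_mx_entry n (S : nat -> 'M[K]_n.+1) (L : 'M[K]_n.+1) i j :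
  S @ \oo --> L -> (fun k => S k i j) @ \oo --> L i j.
Proof.
move=> /cvg_ballP SL; apply/cvg_ballP => e /SL.
by apply: filterS => k [_]; apply.
Qed.

Lemma limn_mx n (S : nat -> 'M[K]_n.+1) (L : 'M[K]_n.+1) :
  S @ \oo --> L -> limn S = L.
Proof. exact: (cvg_lim (@norm_hausdorff K _)). Qed.

Lemma diag_mxX n (d : 'rV[K]_n.+1) k :
  diag_mx d ^+ k = diag_mx (\row_i d 0 i ^+ k).
Proof.
elim: k => [|k IHk].
  by apply/matrixP => i j; rewrite expr0 !mxE expr0.
rewrite exprS IHk -mulmxE mulmx_diag; congr diag_mx.
by apply/rowP => i; rewrite !mxE exprS.
Qed.

(** Stated as a convergence rather than as a value of [expmx], because the
    limit of the partial sums is also what transfers reality of the entries. *)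
Lemma cvg_exp_diagonalizable n (P P' : 'M[K]_n.+1) (d e : 'rV[K]_n.+1) :
  P' *m P = 1%:M ->
  (forall i, series (fun k => k`!%:R^-1 * d 0 i ^+ k) @ \oo --> e 0 i) ->
  series (fun k => k`!%:R^-1 *: (P *m diag_mx d *m P') ^+ k) @ \oo -->
    P *m diag_mx e *m P'.
Proof.
move=> P'P cvg_e; have PP' := mulmx1C P'P.
have conjX k : (P *m diag_mx d *m P') ^+ k =
    P *m diag_mx (\row_i d 0 i ^+ k) *m P'.
  rewrite -diag_mxX; elim: k => [|k IHk]; first by rewrite !expr0 mulmx1 PP'.
  rewrite !exprS IHk -!mulmxE !mulmxA; congr (_ *m _ *m _).
  by rewrite -[P *m _ *m P' *m P]mulmxA P'P mulmx1.
apply: cvg_mx_entries => i j.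
have -> : (P *m diag_mx e *m P') i j = \sum_b P i b * e 0 b * P' b j.
  by rewrite mul_mx_diag mxE; under eq_bigr do rewrite mxE.
have -> : (fun N =>
      series (fun k => k`!%:R^-1 *: (P *m diag_mx d *m P') ^+ k) N i j) =
    (fun N =>
      \sum_b P i b * series (fun k => k`!%:R^-1 * d 0 b ^+ k) N * P' b j).
  apply/funext => N; rewrite /series /= summxE.
  transitivity (\sum_(0 <= k < N) \sum_b
      P i b * (k`!%:R^-1 * d 0 b ^+ k) * P' b j).
    apply: eq_bigr => k _; rewrite conjX mul_mx_diag !mxE mulr_sumr.
    by apply: eq_bigr => b _; rewrite !mxE; ring.
  rewrite exchange_big /=; apply: eq_bigr => b _.
  by rewrite mulr_sumr mulr_suml.
apply: cvg_big => [|b _]; first exact: add_continuous.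
by apply: cvgMr_tmp; apply: cvgMl_tmp.
Qed.

End MatrixExponential.

(** * The complex exponential series *)

Section ComplexConvergence.
Variable R : realType.
Local Open Scope classical_set_scope.
Local Open Scope complex_scope.
Local Notation C := (R[i] : numFieldType).

Lemma cvg_real_complex (a : nat -> R) (l : R) :
  a @ \oo --> l -> (fun k => (a k)%:C : C) @ \oo --> (l%:C : C).
Proof.
move=> /cvgrPdist_lt a_l; apply/cvgrPdist_lt => e.
rewrite ltcE => /andP[/eqP/= Im0 e0].
near=> k.
rewrite -rmorphB normc_def /= expr0n addr0 sqrtr_sqr.
rewrite ltcE /= Im0 eqxx /=; near: k; exact: a_l.
Unshelve. all: by end_near. Qed.

Lemma cvg_complex (a b : nat -> R) (x y : R) :
  a @ \oo --> x -> b @ \oo --> y ->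
  (fun k => (a k +i* b k) : C) @ \oo --> (x +i* y : C).
Proof.
move=> /cvg_real_complex ax /cvg_real_complex bY.
have -> : (fun k => (a k +i* b k) : C) =
    (fun k => (a k)%:C + 'i * (b k)%:C : C).
  by apply/funext => k; rewrite [LHS]complexE.
rewrite [x +i* y]complexE.
exact: (@cvgD C C nat \oo _ _ _ _ _ ax
  (@cvgMl_tmp C nat \oo _ _ ('i : C) _ bY)).
Qed.

(** If the limit had a nonzero imaginary part, that part would bound the
    distance to every term from below. *)
Lemma cvg_Creal (a : nat -> C) (l : C) :
  (forall k, a k \is Num.real) -> a @ \oo --> l -> l \is Num.real.
Proof.
move=> a_real /cvgrPdist_lt a_l; apply/negPn/negP => l_nreal.
have Iml : complex.Im l != 0.
  by case: l l_nreal {a_l} => x y; rewrite complex_real.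
have e0 : 0 < `|complex.Im l|%:C by rewrite ltcR normr_gt0.
have [k] := filter_ex (a_l _ e0).
rewrite le_gtF //.
have -> : complex.Im l = complex.Im (l - a k).
  case: l (a k) (a_real k) {a_l l_nreal Iml e0} => x y [x' y'].
  by rewrite complex_real /= => /eqP->; rewrite subr0.
case: (l - a k) => x y; rewrite normc_def lecR /= -sqrtr_sqr ler_wsqrtr //.
by rewrite lerDr sqr_ge0.
Qed.

Definition cis (x : R) : R[i] := cos x +i* sin x.

Lemma cisD x y : cis (x + y) = cis x * cis y.
Proof.
rewrite /cis cosD sinD; apply/eqP; rewrite eq_complex /=.
by apply/andP; split; apply/eqP; ring.
Qed.

(** The real and imaginary parts are the cosine and sine series. *)
Lemma cvg_cis (x : R) :
  series (fun k => k`!%:R^-1 * ('i * x%:C) ^+ k : C) @ \oo --> (cis x : C).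
Proof.
have i2 m : 'i ^+ m.*2 = ((-1) ^+ m)%:C :> R[i].
  by rewrite -mul2n exprM sqr_i rmorphXn rmorphN1.
have cis_coeff k : k`!%:R^-1 * ('i * x%:C) ^+ k =
    cos_coeff x k +i* sin_coeff x k :> R[i].
  rewrite exprMn -rmorphXn -[in 'i ^+ k](odd_double_half k) exprD i2.
  rewrite -[k`!%:R](rmorph_nat (real_complex R)) -fmorphV.
  rewrite /cos_coeff /sin_coeff /= -exprnP -[k in k.-1](odd_double_half k).
  case: (odd k); rewrite /= ?add0n ?mul0r ?mul1r ?doubleK.
    by simpc; congr (_ *i); rewrite mulrC.
  by rewrite -!rmorphM mulrC.
have -> : series (fun k => k`!%:R^-1 * ('i * x%:C) ^+ k : C) =
    (fun k => series (cos_coeff x) k +i* series (sin_coeff x) k : C).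
  apply/funext => N; rewrite /series /=.
  elim: N => [|N IHN]; first by rewrite !big_geq.
  by rewrite !big_nat_recr //= IHN cis_coeff.
rewrite /cis cos.unlock sin.unlock.
by apply: cvg_complex; [exact: is_cvg_series_cos_coeff
                       |exact: is_cvg_series_sin_coeff].
Qed.

Lemma cis_pihalf k : cis (k%:R * (pi / 2)) = 'i ^+ k.
Proof.
elim: k => [|k IHk]; first by rewrite mul0r /cis cos0 sin0.
by rewrite -natr1 mulrDl mul1r cisD IHk exprSr /cis cos_pihalf sin_pihalf.
Qed.

Lemma cis_unit x : (cis x)^* * cis x = 1.
Proof.
apply/eqP; rewrite eq_complex /= mulNr opprK -!expr2 cos2Dsin2 eqxx /=.
by apply/eqP; ring.
Qed.

End ComplexConvergence.

(** * Eigenspaces *)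

Lemma scale_colE (K : nzRingType) n (A : 'M[K]_n.+1) a k d :
  (a *: col d A) k 0 = a * A k d.
Proof. by rewrite !mxE. Qed.

Lemma intertwiner_col (K : comNzRingType) n (X A : 'M[K]_n.+1)
    (z : 'rV_n.+1) d :
  X *m A = A *m diag_mx z -> X *m col d A = z 0 d *: col d A.
Proof.
move=> XA; apply/colP => k; have := congr1 (fun B : 'M[K]_n.+1 => B k d) XA.
rewrite mul_mx_diag !mxE mulrC => <-.
by apply: eq_bigr => l _; rewrite mxE.
Qed.

Lemma sqr_eq1_sign (K : idomainType) (c : K) : c ^+ 2 = 1 ->
  exists s : bool, c = (-1) ^+ s.
Proof.
move=> /eqP; rewrite sqrf_eq1 => /orP[]/eqP->; first by exists false.
by exists true.
Qed.

(** An involution [M] with [X M = - M Z] for a diagonal [Z] exchanges [X]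
    and [- Z] by conjugation; its columns are then the eigenvectors of [X]. *)
Section Swap.
Variables (K : fieldType) (n : nat) (X M : 'M[K]_n.+1) (z : 'I_n.+1 -> K).
Hypothesis MM : M *m M = 1%:M.
Hypothesis XM : X *m M = - (M *m diag_mx (\row_k z k)).

Lemma swap_conj : M *m X *m M = - diag_mx (\row_k z k).
Proof. by rewrite -mulmxA XM mulmxN mulmxA MM mul1mx. Qed.

Lemma swap_conj_diag : M *m diag_mx (\row_k z k) *m M = - X.
Proof. by rewrite -[M *m _]opprK -XM mulNmx -mulmxA MM mulmx1. Qed.

Lemma swap_col d : X *m col d M = - z d *: col d M.
Proof.
apply/colP => k; have := congr1 (fun B : 'M[K]_n.+1 => B k d) XM.
rewrite mul_mx_diag !mxE mulrC -mulNr => <-.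
by apply: eq_bigr => l _; rewrite mxE.
Qed.

(** Applying [M] turns an eigenvector of [X] into one of the diagonal
    matrix, and a simple spectrum leaves only one coordinate. *)
Lemma swap_eigenspace d (v : 'cV[K]_n.+1) : injective z ->
  X *m v = - z d *: v -> v = (M *m v) d 0 *: col d M.
Proof.
move=> z_inj Xv; set w := M *m v.
have Mw : M *m w = v by rewrite mulmxA MM mul1mx.
have Zw : diag_mx (\row_k z k) *m w = z d *: w.
  rewrite -[diag_mx _]opprK -swap_conj mulNmx -!mulmxA Mw Xv.
  by rewrite -scalemxAr scaleNr opprK.
have w_supp k : k != d -> w k 0 = 0.
  move=> ne_kd; have := congr1 (fun B : 'cV_n.+1 => B k 0) Zw.
  rewrite mul_diag_mx !mxE => /eqP; rewrite -subr_eq0 -mulrBl mulf_eq0 subr_eq0.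
  by rewrite (inj_eq z_inj) (negPf ne_kd) => /eqP.
rewrite -[LHS]Mw; apply/colP => k; rewrite [LHS]mxE (bigD1 d) //=.
rewrite big1 => [|l /w_supp->]; last by rewrite mulr0.
by rewrite addr0 !mxE mulrC.
Qed.

End Swap.

(** * The rotation by a quarter turn about the y axis *)

(** The definitions of [Jx] and [Jy] nest two tests; this view resolves both
    in one case analysis. *)
Variant neighbours (k l : nat) : bool -> bool -> Prop :=
| Up of k = l.+1 : neighbours k l true false
| Down of l = k.+1 : neighbours k l false true
| Apart of k != l.+1 & l != k.+1 : neighbours k l false false.

Lemma neighboursP k l : neighbours k l (k == l.+1) (l == k.+1).
Proof.
have [Ekl|ne1] := eqVneq k l.+1.
  by rewrite (_ : (l == k.+1) = false); [constructor | lia].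
by have [Elk|ne2] := eqVneq l k.+1; constructor.
Qed.

(** With [w' = w^*] and [E' = E^*] the first factor is the adjoint of the
    second, in which everything then cancels in pairs. *)
Lemma unitary_word (K : comNzRingType) n (E E' N : 'M[K]_n.+1) (w w' : K) :
  w' * w = 1 ->
  E' *m E = 1%:M -> E *m E' = 1%:M -> N *m N = 1%:M ->
  E^T = E -> E'^T = E' -> N^T = N ->
  (w' *: (E' *m N *m E *m (N *m E)))^T *m
    (w *: (E *m N *m E' *m (N *m E'))) = 1%:M.
Proof.
move=> w1 E'E EE' NN trE trE' trN.
rewrite -scalemxAr linearZ /= -scalemxAl scalerA mulrC w1 scale1r.
rewrite !trmx_mul trN trE trE' !mulmxA -[_ *m E' *m E]mulmxA E'E mulmx1.
rewrite -[_ *m N *m N]mulmxA NN mulmx1 -[_ *m E *m E']mulmxA EE' mulmx1.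
by rewrite -[_ *m N *m N]mulmxA NN mulmx1 EE'.
Qed.

Local Open Scope complex_scope.

Lemma unitary_col (R : realType) n (A : 'M[R[i]]_n.+1) j :
  (map_mx (@conjc R) A)^T *m A = 1%:M -> \sum_k conjc (A k j) * A k j = 1.
Proof.
move=> A1; have := congr1 (fun B : 'M[R[i]]_n.+1 => B j j) A1.
rewrite mxE [RHS]mxE eqxx mulr1n => <-.
by apply: eq_bigr => k _; rewrite !mxE.
Qed.

Section Rotation.
Variables (R : realType) (n : nat).
Local Open Scope classical_set_scope.
Local Notation C := (R[i] : numFieldType).
Local Notation M := (map_mx (real_complex R) (kraw_mx R n)).

Lemma spin_inj : injective (@spin R n).
Proof. by move=> i j /addIr/eqP; rewrite eqr_nat => /eqP/val_inj. Qed.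

Lemma spin_rev (j : 'I_n.+1) : spin R (rev_ord j) = - spin R j.
Proof. by rewrite /spin /= subSS natrB -1?ltnS //; field. Qed.

(** The rotation by a quarter turn about the z axis, up to a scalar. *)
Definition phase : 'M[R[i]]_n.+1 := diag_mx (\row_k (- 'i) ^+ k).
Definition phaseV : 'M[R[i]]_n.+1 := diag_mx (\row_k 'i ^+ k).

Let NiiX k : (- 'i) ^+ k * 'i ^+ k = 1 :> R[i].
Proof. by rewrite -exprMn mulNr -expr2 sqr_i opprK expr1n. Qed.

Lemma phaseV_phase : phaseV *m phase = 1%:M.
Proof.
rewrite mulmx_diag -diag_const_mx; congr diag_mx; apply/rowP => k.
by rewrite !mxE mulrC NiiX.
Qed.

Lemma phase_conjE (X : 'M[R[i]]_n.+1) k l :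
  (phase *m X *m phaseV) k l = (- 'i) ^+ k * 'i ^+ l * X k l.
Proof. by rewrite mul_mx_diag mul_diag_mx !mxE; ring. Qed.

Lemma Jx_supp (k l : 'I_n.+1) : 
  k != l.+1 :> nat -> l != k.+1 :> nat -> Jx R n k l = 0.
Proof. by rewrite mxE => /negPf-> /negPf->. Qed.

(** A quarter turn about the z axis takes [Jx] to [Jy] and [Jy] to [- Jx]. *)
Lemma phase_conj_Jx : Jy R n = phase *m Jx R n *m phaseV.
Proof.
apply/matrixP => k l; rewrite phase_conjE [LHS]mxE.
case: (neighboursP k l) => [Ekl|Elk|ne1 ne2].
- by rewrite Ekl exprS -[_ * _ * 'i ^+ l]mulrA NiiX mulr1.
- by rewrite Elk exprSr mulrA NiiX mul1r.
- by rewrite Jx_supp // mulr0.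
Qed.

Lemma phase_conj_Jy : phase *m Jy R n *m phaseV = - Jx R n.
Proof.
apply/matrixP => k l; rewrite phase_conjE [Jy _ _ _ _]mxE [RHS]mxE.
case: (neighboursP k l) => [Ekl|Elk|ne1 ne2].
- rewrite Ekl exprS -[_ * _ * 'i ^+ l]mulrA NiiX mulr1 mulrA mulrNN -expr2.
  by rewrite sqr_i mulN1r.
- by rewrite Elk exprSr [_ * (_ * 'i)]mulrA NiiX mul1r mulrA -expr2 sqr_i mulN1r.
- by rewrite Jx_supp // oppr0 mulr0.
Qed.

Lemma Jy_commutator : Jy R n = - 'i *: (Jz R n *m Jx R n - Jx R n *m Jz R n).
Proof.
apply/matrixP => k l.
have comm : (Jz R n *m Jx R n - Jx R n *m Jz R n) k l =
    (spin R k - spin R l)%:C * Jx R n k l.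
  by rewrite mul_diag_mx mul_mx_diag !mxE (rmorphB _ (spin R k)); ring.
rewrite [RHS]mxE comm mxE.
case: (neighboursP k l) => [Ekl|Elk|ne1 ne2].
- by rewrite /spin (_ : _ - _ = 1) ?rmorph1 ?mul1r // Ekl -natr1; ring.
- by rewrite /spin (_ : _ - _ = -1) ?rmorphN1 ?mulN1r ?mulrNN // Elk -natr1; ring.
- by rewrite Jx_supp // !mulr0.
Qed.

Lemma kraw_mxC_invol : M *m M = 1%:M.
Proof. by rewrite -map_mxM kraw_mx_invol map_mx1. Qed.

Lemma Jx_kraw_mxC : Jx R n *m M = - (M *m diag_mx (\row_k (spin R k)%:C)).
Proof. by rewrite -/(Jz R n) Jx_map Jz_map -!map_mxM real_Jx_kraw_mx map_mxN. Qed.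

(** Conjugation by the Krawtchouk matrix exchanges [Jx] and [- Jz], hence
    reverses the commutator in [Jy_commutator]. *)
Lemma kraw_mxC_conj_Jy : M *m Jy R n *m M = - Jy R n.
Proof.
have swapX := swap_conj kraw_mxC_invol Jx_kraw_mxC.
have swapZ := swap_conj_diag kraw_mxC_invol Jx_kraw_mxC.
have swap2 X Y : M *m (X *m Y) *m M = (M *m X *m M) *m (M *m Y *m M).
  by rewrite !mulmxA -[_ *m M *m M]mulmxA kraw_mxC_invol mulmx1.
rewrite Jy_commutator -scalemxAr -scalemxAl mulmxBr mulmxBl !swap2 swapX swapZ.
by rewrite !mulNmx !mulmxN !opprK -scalerN opprB.
Qed.

(** The exponential in closed form: the rotation about y is conjugate to
    one about z, whose exponential at a quarter turn is [phaseV] up to a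
    scalar. *)
Definition rot_pihalf : 'M[R[i]]_n.+1 :=
  cis (- (n%:R / 2 * (pi / 2))) *: (phase *m M *m phaseV *m (M *m phaseV)).

Lemma rotation_generator_spectral (theta : R) : - 'i * theta%:C *: Jy R n =
  (phase *m M) *m diag_mx (\row_k ('i * (theta * spin R k)%:C)) *m
    (M *m phaseV).
Proof.
have -> : diag_mx (\row_k ('i * (theta * spin R k)%:C)) =
    'i * theta%:C *: Jz R n.
  apply/matrixP => k l; rewrite !mxE rmorphM mulrA.
  by case: (k == l); rewrite ?mulr1n ?mulr0n ?mulr0.
rewrite -scalemxAr -scalemxAl !mulmxA -[phase *m M *m _]mulmxA.
rewrite -[phase *m _ *m M]mulmxA (swap_conj_diag kraw_mxC_invol Jx_kraw_mxC).
by rewrite mulmxN mulNmx -phase_conj_Jx mulNr scaleNr scalerN.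
Qed.

Lemma cvg_rotation :
  series (fun k =>
    k`!%:R^-1 *: (- 'i * (pi / 2)%:C *: Jy R n : 'M[C]_n.+1) ^+ k) @ \oo -->
  (rot_pihalf : 'M[C]_n.+1).
Proof.
rewrite rotation_generator_spectral.
have -> : rot_pihalf = (phase *m M) *m
    diag_mx (\row_k cis (pi / 2 * spin R k)) *m (M *m phaseV).
  rewrite /rot_pihalf; have -> : diag_mx (\row_k cis (pi / 2 * spin R k)) =
      cis (- (n%:R / 2 * (pi / 2))) *: phaseV.
    apply/matrixP => k l; rewrite !mxE -cis_pihalf mulrnAr -cisD.
    congr (_ *+ _); congr cis; rewrite /spin; ring.
  by rewrite -scalemxAr -scalemxAl.
apply: (@cvg_exp_diagonalizable C).
  rewrite !mulmxA -[_ *m phaseV *m phase]mulmxA phaseV_phase mulmx1.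
  exact: kraw_mxC_invol.
move=> k; rewrite !mxE; exact: cvg_cis.
Qed.

Lemma rotation_yE : rotation_y n (pi / 2%:R : R) = rot_pihalf.
Proof. exact: (@limn_mx C _ _ _ cvg_rotation). Qed.

(** The generator [- 'i *: Jy] has real entries, hence so do the partial
    sums of its exponential series; the closed form does not show this. *)
Lemma rot_pihalf_real k j : rot_pihalf k j \is Num.real.
Proof.
apply: (@cvg_Creal R _ _ _ (@cvg_mx_entry C _ _ _ k j cvg_rotation)) => N.
have gen_real a b : (- 'i * (pi / 2)%:C *: Jy R n) a b \is Num.real.
  have JxC : Jx R n a b = (real_Jx R n a b)%:C by rewrite Jx_map mxE.
  rewrite mxE [Jy _ _ _ _]mxE JxC; case: (neighboursP a b) => _.
  - rewrite mulrACA mulrNN -expr2 sqr_i mulN1r rpredN -rmorphM.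
    by apply/complex_realP; eexists.
  - rewrite mulrACA mulNr -expr2 sqr_i opprK mul1r -rmorphM.
    by apply/complex_realP; eexists.
  - by rewrite mulr0 real0.
rewrite /series /= summxE rpred_sum // => p _.
rewrite mxE rpredM ?rpredV ?rpred_nat //.
elim: p k => [|p IHp] k; first by rewrite expr0 mxE; exact: realn.
by rewrite exprS mxE rpred_sum // => l _; rewrite rpredM ?gen_real ?IHp.
Qed.

(** A quarter turn about the y axis takes the z axis to the x axis. Moving
    [Jx] through the five factors of [rot_pihalf], it becomes in turn
    [- Jy], [Jy], [- Jx], [Jz], [Jz]. *)
Lemma rot_pihalf_Jx : Jx R n *m rot_pihalf = rot_pihalf *m Jz R n.
Proof.
rewrite /rot_pihalf -scalemxAr -scalemxAl; congr (_ *: _).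
have JxE : Jx R n *m phase = - (phase *m Jy R n).
  rewrite -[Jx R n]opprK -phase_conj_Jy mulNmx.
  by rewrite -[_ *m phaseV *m phase]mulmxA phaseV_phase mulmx1.
have JyM : Jy R n *m M = - (M *m Jy R n).
  rewrite -[Jy R n in LHS]opprK -kraw_mxC_conj_Jy mulNmx.
  by rewrite -[_ *m M *m M]mulmxA kraw_mxC_invol mulmx1.
have JyE' : Jy R n *m phaseV = - (phaseV *m Jx R n).
  by rewrite -mulmxN -phase_conj_Jy !mulmxA phaseV_phase mul1mx.
have JzE' : Jz R n *m phaseV = phaseV *m Jz R n by exact: diag_mxC.
rewrite !mulmxA JxE !mulNmx -!mulmxA (mulmxA (Jy R n)) JyM !mulNmx !mulmxN opprK.
rewrite -!mulmxA (mulmxA (Jy R n)) JyE' !mulNmx !mulmxN -!mulmxA.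
rewrite (mulmxA (Jx R n)) Jx_kraw_mxC.
by rewrite !mulNmx !mulmxN opprK -!mulmxA -/(Jz R n) JzE'.
Qed.

Lemma rot_pihalf_unitary :
  (map_mx (@conjc R) rot_pihalf)^T *m rot_pihalf = 1%:M.
Proof.
have EE' : phase *m phaseV = 1%:M := mulmx1C phaseV_phase.
have conj_i : 'i^* = - 'i :> R[i].
  by apply/eqP; rewrite eq_complex /= oppr0 !eqxx.
have conjX (x y : R[i]) p (b : bool) : x^* = y -> (x ^+ p *+ b)^* = y ^+ p *+ b.
  by move=> <-; rewrite rmorphMn rmorphXn.
have conjE : map_mx (@conjc R) phase = phaseV.
  by apply/matrixP => k l; rewrite !mxE; apply: conjX; rewrite -conj_i conjcK.
have conjE' : map_mx (@conjc R) phaseV = phase.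
  by apply/matrixP => k l; rewrite !mxE; apply: conjX.
have conjM : map_mx (@conjc R) M = M.
  by apply/matrixP => k l; rewrite !mxE; apply: conjc_real.
have trM : M^T = M by rewrite map_trmx kraw_mx_sym.
have trE : phase^T = phase by exact: tr_diag_mx.
have trE' : phaseV^T = phaseV by exact: tr_diag_mx.
rewrite /rot_pihalf map_mxZ !map_mxM conjE conjE' conjM.
exact: (unitary_word (cis_unit _) phaseV_phase EE' kraw_mxC_invol trE trE' trM).
Qed.

End Rotation.

(** * The eigenbasis, the rotation and the semigroup *)

Section Assembly.
Variables (R : realType) (n : nat).
Local Notation M := (kraw_mx R n).

Lemma kraw_mx_col_unit (d d' : 'I_n.+1) :
  ((col d M)^T *m col d' M) 0 0 = (d == d')%:R.
Proof.
have := congr1 (fun B : 'M[R]_n.+1 => B d d') (kraw_mx_invol R n).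
rewrite -{1}kraw_mx_sym [RHS]mxE => <-; rewrite !mxE.
by apply: eq_bigr => k _; rewrite !mxE.
Qed.

Lemma Asym_eigenP (j : 'I_n.+1) (v : 'cV[R]_n.+1) : (0 < n)%N ->
  Asym R n *m v = (2%:R * spin R j / n%:R) *: v <->
  real_Jx R n *m v = spin R j *: v.
Proof.
move=> n_gt0; have c0 : 2 / n%:R != 0 :> R.
  by rewrite mulf_neq0 // ?invr_eq0 pnatr_eq0 // -lt0n.
rewrite Asym_real_Jx // -scalemxAl mulrAC -(scalerA _ (spin R j)).
by split=> [eqv|->//]; apply: (scalerI c0).
Qed.

Lemma sym_eigenbasis_exists : (0 < n)%N ->
  sym_eigenbasis (fun j => col (rev_ord j) M).
Proof.
move=> n_gt0; split=> [j|i j].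
  apply/Asym_eigenP => //.
  by rewrite (swap_col (real_Jx_kraw_mx R n)) spin_rev opprK.
by rewrite kraw_mx_col_unit (inj_eq rev_ord_inj).
Qed.

(** The eigenspaces are lines and the vectors are real of norm one, which
    leaves a sign. *)
Lemma sym_eigenbasis_unique (u : 'I_n.+1 -> 'cV[R]_n.+1) : (0 < n)%N ->
  sym_eigenbasis u ->
  forall j, exists s : bool, u j = (-1) ^+ s *: col (rev_ord j) M.
Proof.
move=> n_gt0 [uE u1] j.
have /(Asym_eigenP _ _ n_gt0) uj := uE j.
have := swap_eigenspace (kraw_mx_invol R n) (real_Jx_kraw_mx R n)
  (d := rev_ord j) (v := u j) (@spin_inj R n).
rewrite spin_rev opprK => /(_ uj); set c := (_ *m _) _ _ => ujE.
suff /sqr_eq1_sign[s cs] : c ^+ 2 = 1 by exists s; rewrite -cs.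
have := u1 j j; rewrite ujE -scalemxAr linearZ /= -scalemxAl scalerA mxE.
by rewrite kraw_mx_col_unit !eqxx mulr1.
Qed.

Lemma Jx_eigenspace (j : 'I_n.+1) (v : 'cV[R[i]]_n.+1) :
  Jx R n *m v = (spin R j)%:C *: v ->
  v = (map_mx (real_complex R) M *m v) (rev_ord j) 0 *:
      map_mx (real_complex R) (col (rev_ord j) M).
Proof.
move=> vE; rewrite map_col.
apply: (swap_eigenspace (kraw_mxC_invol R n) (Jx_kraw_mxC R n)).
  by move=> k l /complexI/spin_inj.
by rewrite vE spin_rev rmorphN opprK.
Qed.

(** The column is an eigenvector of [Jx], so a multiple [c] of the
    Krawtchouk column. Since it is real and has hermitian norm one, its
    bilinear square is one too, and it equals [c ^+ 2]. *)
Lemma rot_pihalf_col j : exists s : bool, forall k,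
  rot_pihalf R n k j = (-1) ^+ s * (M k (rev_ord j))%:C.
Proof.
have eigj : Jx R n *m col j (rot_pihalf R n) =
    (spin R j)%:C *: col j (rot_pihalf R n).
  by rewrite (intertwiner_col j (rot_pihalf_Jx R n)) mxE.
have := Jx_eigenspace eigj; set c := (_ *m _) _ _ => rotE.
have rotkE k : rot_pihalf R n k j = c * (M k (rev_ord j))%:C.
  by have := congr1 (fun B : 'cV[R[i]]_n.+1 => B k 0) rotE; rewrite !mxE.
suff /sqr_eq1_sign[s cs] : c ^+ 2 = 1 by exists s => k; rewrite rotkE cs.
rewrite -(unitary_col j (rot_pihalf_unitary R n)).
transitivity (c ^+ 2 * (((col (rev_ord j) M)^T *m col (rev_ord j) M) 0 0)%:C).
  by rewrite kraw_mx_col_unit eqxx mulr1.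
rewrite mxE rmorph_sum mulr_sumr; apply: eq_bigr => k _.
have conj_real (x : R[i]) : x \is Num.real -> x^* = x.
  by move=> /complex_realP[y ->]; apply: conjc_real.
rewrite conj_real ?rot_pihalf_real // rotkE rmorphM.
rewrite [_^T _ _]mxE [(col _ M) _ _]mxE; ring.
Qed.

Lemma kraw_mx_rescaled (k d : 'I_n.+1) :
  M k d / Num.sqrt (nu R k) = (norm_krawtchouk R n d).[k%:R].
Proof.
rewrite mxE hornerZ horner_krawtchouk; last by rewrite -ltnS.
have -> : Num.sqrt 'C(n, d)%:R = Num.sqrt (2 ^+ n) * Num.sqrt (nu R d) :> R.
  by rewrite -sqrtrM ?exprn_ge0 // mulrA divff ?mul1r // expf_neq0 // pnatr_eq0.
have s0 : Num.sqrt (2 ^+ n) != 0 :> R by rewrite sqrtr_eq0 -ltNge exprn_gt0.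
by field; rewrite s0 !sqrt_nu_neq0.
Qed.

(** The exponential is applied to the eigenvalues in [ehrenfestQ_spectral];
    the gauge contributes the two square roots. *)
Lemma expmx_ehrenfestQ (t : R) k l : expmx (t *: ehrenfestQ R n) k l =
  Num.sqrt (nu R l) / Num.sqrt (nu R k) *
    \sum_(d < n.+1) expR (- 2 * d%:R * t) * M k d * M l d.
Proof.
have -> : t *: ehrenfestQ R n = (invmx (gaugeD R n) *m M) *m
    diag_mx (\row_d (- 2 * d%:R * t)) *m (M *m gaugeD R n).
  rewrite ehrenfestQ_spectral scalemxAl scalemxAr; congr (_ *m _ *m _).
  apply/matrixP => i j; rewrite !mxE.
  case: (i == j); rewrite ?mulr0n ?mulr0 // !mulr1n; ring.
have -> : expmx ((invmx (gaugeD R n) *m M) *m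
      diag_mx (\row_d (- 2 * d%:R * t)) *m (M *m gaugeD R n)) =
    (invmx (gaugeD R n) *m M) *m
      diag_mx (\row_d (expR (- 2 * d%:R * t))) *m (M *m gaugeD R n).
  apply: limn_mx; apply: cvg_exp_diagonalizable.
    rewrite !mulmxA mulmxK ?gauge_unit // kraw_mx_invol //.
  move=> d; rewrite !mxE.
  have -> : (fun k => k`!%:R^-1 * (- 2 * d%:R * t) ^+ k) =
      exp_coeff (- 2 * d%:R * t).
    by apply/funext => p; rewrite /exp_coeff /= mulrC.
  exact: is_cvg_series_exp_coeff.
have invE d : (invmx (gaugeD R n) *m M) k d = M k d / Num.sqrt (nu R k).
  apply: (mulIf (sqrt_nu_neq0 R k)); rewrite divfK ?sqrt_nu_neq0 //.
  have := congr1 (fun B : 'M[R]_n.+1 => B k d) (mulKVmx (gauge_unit R n) M).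
  by rewrite mul_diag_mx [LHS]mxE [(\row__ _) _ _]mxE => <-; rewrite mulrC.
rewrite mxE mulr_sumr; apply: eq_bigr => d _.
have -> : M l d = M d l by rewrite -[in LHS]kraw_mx_sym [LHS]mxE.
rewrite mul_mx_diag [X in X * _]mxE invE.
move: (kraw_mx R n) => N; rewrite mul_mx_diag !mxE; ring.
Qed.
End Assembly.

Theorem proposition7p7 (R : realType) (n : nat) (hn : (1 <= n)%N) :
  (exists u : 'I_n.+1 -> 'cV[R]_n.+1, sym_eigenbasis u) /\
  (forall u : 'I_n.+1 -> 'cV[R]_n.+1, sym_eigenbasis u ->
    ((forall j : 'I_n.+1,
        let uC : 'cV[R[i]]_n.+1 := map_mx (real_complex R) (u j) in
        Jx R n *m uC = (spin R j)%:C *: uC /\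
        (forall v : 'cV[R[i]]_n.+1,
           Jx R n *m v = (spin R j)%:C *: v -> exists c : R[i], v = c *: uC)) /\
     (forall k j : 'I_n.+1, rotation_y n (pi / 2%:R : R) k j \is Num.real) /\
     (forall j : 'I_n.+1, exists s : bool, forall k : 'I_n.+1,
        (u j k 0)%:C = (-1) ^+ s * rotation_y n (pi / 2%:R : R) k j)) /\
    ((forall j : 'I_n.+1, exists s : bool,
        let p : {poly R} := (-1) ^+ s *: norm_krawtchouk R n (n - j) in
        size p = (n - j).+1 /\
        forall k : 'I_n.+1, rescaled u j k = p.[k%:R]) /\
     (forall j j' : 'I_n.+1,
        \sum_(k < n.+1) nu R k * rescaled u j k * rescaled u j' k
          = (j == j')%:R)) /\
    (forall (t : R) (k l : 'I_n.+1),
       expmx (t *: ehrenfestQ R n) k l =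
         Num.sqrt (nu R l) / Num.sqrt (nu R k) *
         \sum_(j < n.+1)
           expR ((2%:R * spin R j - n%:R) * t) * u j k 0 * u j l 0 /\
       expmx (t *: ehrenfestQ R n) k l =
         nu R l *
         \sum_(j < n.+1)
           expR ((2%:R * spin R j - n%:R) * t) * rescaled u j k
             * rescaled u j l)).
Proof.
split.
  exists (fun j => col (rev_ord j) (kraw_mx R n)).
  exact: sym_eigenbasis_exists.
move=> u uP; have u_sign := sym_eigenbasis_unique hn uP.
have sq_nu (k : 'I_n.+1) : nu R k = Num.sqrt (nu R k) ^+ 2.
  by rewrite sqr_sqrtr // ltW // nu_gt0.
have nu0 := @sqrt_nu_neq0 R n.
have expE (t : R) (k l : 'I_n.+1) : expmx (t *: ehrenfestQ R n) k l =
    Num.sqrt (nu R l) / Num.sqrt (nu R k) *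
    \sum_(j < n.+1) expR ((2%:R * spin R j - n%:R) * t) * u j k 0 * u j l 0.
  rewrite expmx_ehrenfestQ (reindex_inj rev_ord_inj); congr (_ * _).
  apply: eq_bigr => j _; have [s ->] := u_sign j.
  rewrite !scale_colE.
  have -> : - 2 * (rev_ord j)%:R * t = (2 * spin R j - n%:R) * t.
    by have := @spin_rev R n j; rewrite /spin => /(canRL (subrK _)) ->; field.
  (* The sign of [u j] enters twice. *)
  rewrite -[LHS]mul1r -{1}(sqrr_sign R s); ring.
split; last split.
- split=> [j uC|].
    have [s us] := u_sign j.
    have colE : map_mx (real_complex R) (col (rev_ord j) (kraw_mx R n)) =
        (-1) ^+ s *: uC.
      by rewrite /uC us map_mxZ rmorph_sign scalerA -expr2 sqrr_sign scale1r.
    have JxC := swap_col (Jx_kraw_mxC R n) (rev_ord j).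
    split=> [|v /Jx_eigenspace vE].
      rewrite -map_col colE -scalemxAr scalerA mulrC -scalerA in JxC.
      rewrite spin_rev rmorphN opprK in JxC.
      exact: (scalerI (negbT (signr_eq0 _ s)) JxC).
    by rewrite {}vE colE scalerA; eexists.
  split=> [k j|j]; first by rewrite rotation_yE rot_pihalf_real.
  have [s us] := u_sign j; have [s' rots] := rot_pihalf_col R j.
  exists (s (+) s') => k; rewrite rotation_yE rots us scale_colE signr_addb.
  by rewrite -mulrA signrMK rmorphM rmorph_sign.
- split=> [j|j j'].
    have [s us] := u_sign j; exists s => p; split.
      rewrite /p size_scale ?signr_eq0 // /norm_krawtchouk size_scale.
        exact: size_krawtchouk.
      by rewrite invr_eq0 sqrtr_eq0 -ltNge ltr0n bin_gt0 leq_subr.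
    move=> k; have := kraw_mx_rescaled R k (rev_ord j); rewrite /= subSS => Mk.
    by rewrite /rescaled us /p hornerZ -Mk scale_colE mulrA.
  have [_ u1] := uP; rewrite -u1 mxE; apply: eq_bigr => k _.
  by rewrite mxE sq_nu /rescaled; field.
move=> t k l; split; first exact: expE.
rewrite expE !mulr_sumr; apply: eq_bigr => j _.
by rewrite [nu R l in RHS]sq_nu /rescaled; field; rewrite !nu0.
Qed.
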